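(* Let $E$ be a field of characteristic different from $2$ and let $v$ be a valuation on $E$ such that $v(E^{\times 2})\neq v(E^\times)$. Then the polynomial $X(X+1)(X+a)\in E[X]$ is not square-reflexive over $E$ for any $a\in \mathcal{O}_v^\times\setminus\{1\}$.
   Context: Valuations are Krull valuations (with values in an arbitrary ordered abelian group, not necessarily $\mathbb{Z}$); $\mathcal{O}_v$ is the valuation ring of $v$. For a commutative ring $R$ let $R^\times$ be its group of units and $R^{\times 2}=\{x^2\mid x\in R^\times\}$; an element of $R$ is square-free if it is not equal to $x^2y$ for any $x\in R\setminus R^\times$ and $y\in R$. For a nonzero $f\in E[X]$ put $E_f=E[X]/(f)$, let $\mathrm{N}_{E_f/E}:E_f\to E$ be the norm of this finite-dimensional $E$-algebra and let $\mathrm{lc}(f)$ be the leading coefficient of $f$. A square-free polynomial $f\in E[X]\setminus\{0\}$ is called square-reflexive if for every $\alpha\in E_f^\times$ with $\mathrm{N}_{E_f/E}(\alpha)\in E^{\times 2}\cup \mathrm{lc}(f)E^{\times 2}$ there exists a polynomial $g\in E[X]$ coprime to $f$ such that $g+(f)\in\alpha E_f^{\times 2}$ and $f+(g)\in E_g^{\times 2}$. *)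

(* Defs.v *)
From HB Require Import structures.
From mathcomp Require Import all_boot all_order all_algebra.
From mathcomp Require Import qpoly.
From mathcomp Require Import boolp classical_sets.

Set Implicit Arguments.
Unset Strict Implicit.
Unset Printing Implicit Defensive.

Import Order.TTheory GRing.Theory Num.Theory.
Local Open Scope ring_scope.
Local Open Scope classical_set_scope.

(* In porderZmodType the order and the group law are unrelated.  Totality is
   put in the mixin because a join with orderType would be a missing join below
   realDomainType. *)
HB.mixin Record isOrderedAbelianGroup G of Num.POrderedZmodule G := {
  oag_le_total : total (<=%R : rel G);
  oag_leD2l : forall z x y : G, x <= y -> z + x <= z + y
}.

#[short(type="orderedAbelianGroup")]
HB.structure Definition OrderedAbelianGroup :=
  { G of Num.POrderedZmodule G & isOrderedAbelianGroup G }.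

(* R is a comPzRingType, so that the zero ring is allowed. *)
Definition units (R : comPzRingType) : set R :=
  [set x | exists y, x * y = 1].

Definition unit_squares (R : comPzRingType) : set R :=
  [set x ^+ 2 | x in @units R].

Definition mul_set (R : comPzRingType) (c : R) (S : set R) : set R :=
  [set c * x | x in S].

Definition square_free (R : comPzRingType) (z : R) : Prop :=
  ~ exists x y : R, ~ units x /\ z = x ^+ 2 * y.

Arguments units : clear implicits.
Arguments unit_squares : clear implicits.

(* A valuation E^* -> G, extended to E by an arbitrary value at 0 instead of
   infinity: nothing below depends on v 0. *)
Record valuation (E : fieldType) (G : orderedAbelianGroup) := Valuation {
  val_fun :> E -> G;
  valuationM : forall x y : E, x != 0 -> y != 0 ->
    val_fun (x * y) = val_fun x + val_fun y;
  valuationD : forall x y : E, x != 0 -> y != 0 -> x + y != 0 ->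
    Order.min (val_fun x) (val_fun y) <= val_fun (x + y)
}.

Definition valuation_ring (E : fieldType) (G : orderedAbelianGroup)
    (v : valuation E G) : set E :=
  [set x | x = 0 \/ 0 <= v x].

Definition valuation_ring_units (E : fieldType) (G : orderedAbelianGroup)
    (v : valuation E G) : set E :=
  [set x | valuation_ring v x /\ exists2 y, valuation_ring v y & x * y = 1].

(* E[X]/(f) for f != 0, represented by remainders modulo f.  The library's
   {poly %/ f} requires f monic and nonconstant; here f need not be monic, and
   the quotient by a nonzero constant is the zero ring.  For f = 0 this is the
   zero ring too, and must not be read as E[X]/(0). *)
Definition poly_quot (E : fieldType) (f : {poly E}) : Type :=
  {poly_((size f).-1) E}.

HB.instance Definition _ (E : fieldType) (f : {poly E}) :=
  Vector.on (poly_quot f).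

Section PolyQuot.
Variables (E : fieldType) (f : {poly E}).

Definition in_quot (p : {poly E}) : poly_quot f :=
  npolyp (size f).-1 (p %% f).

Lemma in_quotE (p : {poly E}) : f != 0 -> in_quot p = p %% f :> {poly E}.
Proof.
move=> f0; rewrite /in_quot npolypK // -ltnS prednK ?ltn_modp //.
by rewrite lt0n size_poly_eq0.
Qed.

Lemma poly_quot_mod (x : poly_quot f) : f != 0 -> x %% f = x :> {poly E}.
Proof.
move=> f0; rewrite modp_small //.
have := size_npoly x; rewrite -ltnS prednK // lt0n size_poly_eq0 //.
Qed.

Lemma in_quotK (x : poly_quot f) : in_quot (x : {poly E}) = x.
Proof.
have [f0|f0] := eqVneq f 0.
  apply/val_inj/polyP => i /=.
  by rewrite !big_coef_npoly // f0 size_poly0.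
by apply: val_inj; rewrite /= in_quotE // poly_quot_mod.
Qed.

Lemma poly_quot_triv (x y : poly_quot f) : f = 0 -> x = y.
Proof.
move=> f0; apply/val_inj/polyP => i /=.
by rewrite !big_coef_npoly // f0 size_poly0.
Qed.

Definition quot_one : poly_quot f := in_quot 1.
Definition quot_mul (x y : poly_quot f) : poly_quot f :=
  in_quot ((x : {poly E}) * (y : {poly E})).

Fact quot_mulA : associative quot_mul.
Proof.
move=> x y z; have [f0|f0] := eqVneq f 0; first exact: poly_quot_triv.
apply: val_inj; rewrite /quot_mul /= !in_quotE //.
by rewrite modp_mul [(_ %% _) * _]mulrC modp_mul mulrA [_ * polyn z]mulrC.
Qed.

Fact quot_mulC : commutative quot_mul.
Proof. by move=> x y; rewrite /quot_mul mulrC. Qed.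

Fact quot_mul1 : left_id quot_one quot_mul.
Proof.
move=> x; have [f0|f0] := eqVneq f 0; first exact: poly_quot_triv.
apply: val_inj; rewrite /quot_mul /quot_one /= !in_quotE //.
by rewrite mulrC modp_mul mulr1 poly_quot_mod.
Qed.

Fact quot_mulDl : left_distributive quot_mul +%R.
Proof.
move=> x y z; have [f0|f0] := eqVneq f 0; first exact: poly_quot_triv.
apply: val_inj; rewrite /quot_mul /= !in_quotE //.
by rewrite -modpD -mulrDl.
Qed.

HB.instance Definition _ := GRing.Zmodule_isComPzRing.Build (poly_quot f)
  quot_mulA quot_mulC quot_mul1 quot_mulDl.

End PolyQuot.

Arguments in_quot {E} f p.

Lemma quot_mulE (E : fieldType) (f : {poly E}) (x y : poly_quot f) :
  x * y = in_quot f ((x : {poly E}) * (y : {poly E})).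
Proof. by []. Qed.

Lemma in_quotD (E : fieldType) (f p q : {poly E}) :
  in_quot f (p + q) = in_quot f p + in_quot f q.
Proof.
have [f0|f0] := eqVneq f 0; first exact: poly_quot_triv.
by apply: val_inj; rewrite /= !in_quotE // modpD.
Qed.

Lemma in_quot1 (E : fieldType) (f : {poly E}) : in_quot f 1 = 1.
Proof. by []. Qed.

Lemma in_quotM (E : fieldType) (f p q : {poly E}) :
  in_quot f (p * q) = in_quot f p * in_quot f q.
Proof.
have [f0|f0] := eqVneq f 0; first exact: poly_quot_triv.
rewrite quot_mulE; apply: val_inj; rewrite /= !in_quotE //.
by rewrite modp_mul [_ %% _ * _]mulrC modp_mul mulrC.
Qed.

Lemma in_quot_eq (E : fieldType) (f p q : {poly E}) : f != 0 ->
  (in_quot f p == in_quot f q) = (f %| p - q)%R.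
Proof.
move=> f0; rewrite -val_eqE /= !in_quotE // /dvdp.
by rewrite modpD modpN subr_eq0.
Qed.

Lemma quot_scalerAl (E : fieldType) (f : {poly E}) (c : E)
  (x y : poly_quot f) : c *: (x * y) = (c *: x) * y.
Proof.
have [f0|f0] := eqVneq f 0; first exact: poly_quot_triv.
by rewrite !quot_mulE; apply: val_inj; rewrite /= !in_quotE // -modpZl scalerAl.
Qed.

(* The determinant of the E-linear endomorphism x |-> alpha * x. *)
Definition quot_norm (E : fieldType) (f : {poly E}) (alpha : poly_quot f) : E :=
  let b := vbasis {:poly_quot f} in
  \det (passmx.mxof b b (linfun (fun x : poly_quot f => alpha * x))).

(* The condition g != 0 makes E[X]/(g) meaningful. *)
Definition square_reflexive (E : fieldType) (f : {poly E}) : Prop :=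
  [/\ f != 0,
      square_free f
    & forall alpha : poly_quot f,
        units (poly_quot f) alpha ->
        (unit_squares E `|` mul_set (lead_coef f) (unit_squares E))
          (quot_norm alpha) ->
        exists g : {poly E},
          [/\ g != 0,
              coprimep g f,
              mul_set alpha (unit_squares (poly_quot f)) (in_quot f g)
            & unit_squares (poly_quot g) (in_quot g f)]].

(* Main.v *)
From HB Require Import structures.
Require Import Defs.
From mathcomp Require Import all_boot all_order all_algebra.
From mathcomp Require Import qpoly ring zify.
From mathcomp Require Import boolp classical_sets.

(** Write f = X(X+1)(X+a).  It has three distinct roots 0, -1, -a, so E_f is
    E^3, and the norm of the class of p is the product of the values of p at
    the roots ([quot_norm_split]).  Pick t whose value is not twice a value,
    and let alpha have the coordinates t, t, 1: its norm t^2 is a square.  We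
    claim that no g answers alpha.

    Behind the claim is complete 2-descent on the elliptic curve y^2 = f(x).
    If f is a square h^2 modulo g, the roots of g are abscissas of points, and
    g(0) is, up to sign and leading coefficient, the image of their sum under
    the component of the descent map at the root 0.  On a rational point (x, y)
    that component is x, and v(x) is always twice a value
    ([even_val_abscissa]): if v(x) < 0, then x+1 and x+a have the value of x,
    and if v(x) > 0, they are units.  Here it matters that a is a unit; when a
    is 1 modulo the maximal ideal the other two components need not behave so
    well, which is why t sits at the root 0.

    The group law of the curve is avoided by a reduction on polynomials
    ([even_val_descent]).  With h reduced modulo g, write h^2 - f = k g.  Then
    k has smaller degree than g, f is again a square modulo k, and
    k(0) g(0) = h(0)^2, so g can be replaced by k until its degree is at most
    one.  The outcome is that g(0) lc(g) has even value, that is, twice a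
    value.

    It remains to remove lc(g).  Computing the norm of f in E[X]/(g) as the
    determinant of f at a companion matrix gives
    g(0) g(-1) g(-a) = +- lc(g)^3 d^2 ([prod_horner_square]).  If g answers
    alpha, the left side is a square, so lc(g) has even value.  Hence so has
    g(0), which lies in t E^2, contradicting the choice of t. *)

Set Implicit Arguments.
Unset Strict Implicit.
Unset Printing Implicit Defensive.

Import Order.TTheory GRing.Theory Num.Theory.
Local Open Scope ring_scope.
Local Open Scope classical_set_scope.

Import passmx.

(** * Split separable quotients of E[X] *)

Section Norm.
Variables (E : fieldType) (f : {poly E}).

Lemma quot_mul_linear (alpha : poly_quot f) :
  linear (fun x : poly_quot f => alpha * x).
Proof.
by move=> c x y; rewrite mulrDr mulrC -quot_scalerAl [x * _]mulrC.
Qed.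

Lemma horner_in_quot (p : {poly E}) (r : E) :
  f != 0 -> root f r -> (in_quot f p : {poly E}).[r] = p.[r].
Proof.
move=> f0 /rootP fr.
by rewrite in_quotE // {2}(divp_eq p f) hornerD hornerM fr mulr0 add0r.
Qed.

(** Evaluation at the roots diagonalizes multiplication: if W is the matrix of
    values of the basis elements at the roots and M the matrix of multiplication
    by p, then M W = W D with D the diagonal matrix of the p(r).  W is
    invertible because a nonzero remainder has fewer roots than f. *)
Lemma quot_norm_split (rs : seq E) (p : {poly E}) :
    uniq rs -> f = \prod_(r <- rs) ('X - r%:P) ->
  quot_norm (in_quot f p) = \prod_(r <- rs) p.[r].
Proof.
move=> urs fE; have f0 : f != 0.
  by rewrite fE monic_neq0 // monic_prod_XsubC.
have fr r : r \in rs -> root f r by rewrite fE root_prod_XsubC.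
pose V := poly_quot f.
have dimV : \dim {:V} = size rs by rewrite dim_polyn fE size_prod_XsubC.
rewrite /quot_norm; set b := vbasis _; set phi := linfun _.
have bb : basis_of {:V} b := vbasisP _.
have phiE x : phi x = in_quot f p * x.
  rewrite /phi; pose m := GRing.isLinear.Build E V V _ _ (quot_mul_linear (in_quot f p)).
  pose l : {linear V -> V} := HB.pack (fun x : V => in_quot f p * x) m.
  exact: (lfunE l x).
pose W : 'M[E]_(\dim {:V}) :=
  \matrix_(i, j) ((b`_i : V) : {poly E}).[rs`_j].
have evW (u : 'rV_(\dim {:V})) j : (u *m W) 0 j = ((vecof b u : V) : {poly E}).[rs`_j].
  rewrite /vecof mxE (@big_morph _ _ (fun x : V => (x : {poly E})) 0 +%R) //.
  by rewrite horner_sum; apply: eq_bigr => i _; rewrite mxE hornerZ.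
have rsP (j : 'I_(\dim {:V})) : rs`_j \in rs by rewrite mem_nth // -dimV.
have Wunit : W \in unitmx.
  rewrite -row_free_unit -kermx_eq0; apply/rowV0P => u /sub_kermxP uW.
  apply/eqP; rewrite -(vecof_eq0 bb); apply/eqP/val_inj/eqP => /=.
  apply/negPn/negP => v0.
  have rts : all (root (vecof b u : V)) rs.
    apply/allP => r /(nthP 0)[i ilt <-].
    have ilt' : (i < \dim {:V})%N by rewrite dimV.
    by rewrite rootE -(evW u (Ordinal ilt')) uW mxE.
  have := max_poly_roots v0 rts urs.
  by rewrite ltnNge -dimV dim_polyn size_npoly.
have MW : mxof b b phi *m W = W *m diag_mx (\row_j p.[rs`_j]).
  apply/row_matrixP => i; apply/rowP => j.
  rewrite row_mul rowE mul_mxof mul_mx_diag evW rVofK // vecof_delta phiE.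
  rewrite quot_mulE horner_in_quot // ?fr // hornerM horner_in_quot // ?fr //.
  by rewrite !mxE mulrC.
have := congr1 determinant MW; rewrite !det_mulmx mulrC => /mulfI ->.
  rewrite det_diag (big_nth 0) big_mkord -dimV.
  by apply: eq_bigr => i _; rewrite mxE.
by rewrite -unitfE -unitmxE.
Qed.
End Norm.

(** The injectivity half of the Chinese remainder theorem. *)
Lemma in_quot_eq_split (E : fieldType) (f : {poly E}) (rs : seq E)
    (p q : {poly E}) :
    uniq rs -> f = \prod_(r <- rs) ('X - r%:P) ->
    (forall r, r \in rs -> p.[r] = q.[r]) ->
  in_quot f p = in_quot f q.
Proof.
move=> urs fE pq; apply/eqP; rewrite in_quot_eq; last first.
  by rewrite fE monic_neq0 // monic_prod_XsubC.
rewrite fE uniq_roots_dvdp ?uniq_rootsE //; apply/allP => r rrs.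
by rewrite rootE hornerD hornerN pq // subrr.
Qed.

(** * The norm of f in E[X]/(g) *)

Section Resultant.
Variable E : fieldType.

Lemma prod_mull_seq (I : Type) (s : seq I) (c : E) (F : I -> E) :
  \prod_(i <- s) (c * F i) = c ^+ size s * \prod_(i <- s) F i.
Proof. by rewrite big_split /= big_const_seq count_predT iter_mulr_1. Qed.

Lemma det_horner_XsubC n (A : 'M[E]_n.+1) (r : E) :
  \det (horner_mx A ('X - r%:P)) = (-1) ^+ n.+1 * (char_poly A).[r].
Proof.
rewrite raddfB /= horner_mx_X horner_mx_C -[A - _]opprB -scaleN1r detZ.
congr (_ * _); rewrite -horner_evalE -det_map_mx; congr (\det _).
apply/matrixP => i j; rewrite !mxE /= /horner_eval.
by rewrite hornerD hornerN hornerC hornerMn hornerX.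
Qed.

(** By Cayley-Hamilton the product of the X - r, evaluated at A, equals h(A)^2.
    Take determinants: det(A - r) is, up to sign, the characteristic polynomial
    at r, and the right side becomes the square of det h(A). *)
Lemma prod_char_poly_square n (A : 'M[E]_n) (rs : seq E) (h : {poly E}) :
    char_poly A %| h ^+ 2 - \prod_(r <- rs) ('X - r%:P) ->
  exists (k : nat) (d : E),
    \prod_(r <- rs) (char_poly A).[r] = (-1) ^+ k * d ^+ 2.
Proof.
case: n A => [|n] A.
  exists 0, 1; rewrite expr1n mulr1 big1 // => r _.
  by rewrite /char_poly det_mx00 hornerC.
move=> /dvdpP[q hq]; exists (n.+1 * size rs)%N, (\det (horner_mx A h)).
have := congr1 (horner_mx A) hq.
rewrite rmorphM /= Cayley_Hamilton mulr0 rmorphB rmorphXn rmorph_prod /=.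
move=> /subr0_eq hE.
rewrite expr2 -det_mulmx -[_ *m _]/(_ * _) -expr2 hE.
rewrite (big_morph _ (@det_mulmx E n.+1) (@det1 E n.+1)).
rewrite (eq_bigr _ (fun r _ => det_horner_XsubC A r)) prod_mull_seq.
by rewrite mulrA -exprM -exprD addnn -signr_odd odd_double mul1r.
Qed.

(** The resultant of g and the product of the X - r, in the case where the
    latter is a square modulo g. *)
Lemma prod_horner_square (rs : seq E) (g h : {poly E}) :
    g != 0 -> g %| h ^+ 2 - \prod_(r <- rs) ('X - r%:P) ->
  exists (k : nat) (d : E), \prod_(r <- rs) g.[r]
    = (-1) ^+ k * lead_coef g ^+ size rs * d ^+ 2.
Proof.
move=> g0 gdvd; have lc0 : lead_coef g != 0 by rewrite lead_coef_eq0.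
pose g1 := (lead_coef g)^-1 *: g.
have g1E : char_poly (companionmx g1) = g1.
  by apply: companionmxK; rewrite monicE lead_coefZ mulVf.
have [|k [d dE]] := @prod_char_poly_square _ (companionmx g1) rs h.
  by rewrite g1E dvdpZl // invr_eq0.
exists k, d; rewrite mulrAC -dE mulrC g1E -prod_mull_seq.
by apply: eq_bigr => r _; rewrite hornerZ mulVKf.
Qed.
End Resultant.

(** * Values modulo twice the value group *)

Section Valuation.
Variables (E : fieldType) (G : orderedAbelianGroup) (v : valuation E G).

Lemma val1 : v 1 = 0.
Proof.
by apply: (addrI (v 1)); rewrite -valuationM ?oner_eq0 // mulr1 addr0.
Qed.

Lemma valN1 : v (-1) = 0.
Proof.
have N1 : -1 != 0 :> E by rewrite oppr_eq0 oner_eq0.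
have vv : v (-1) + v (-1) = 0 by rewrite -valuationM // mulrNN mulr1 val1.
apply/eqP; rewrite eq_le.
have /orP[le|le] := oag_le_total (v (-1)) 0; rewrite le ?andbT /=;
  by have := oag_leD2l (v (-1)) _ _ le; rewrite vv addr0.
Qed.

Lemma valN x : x != 0 -> v (- x) = v x.
Proof.
by move=> x0; rewrite -mulN1r valuationM ?oppr_eq0 ?oner_eq0 // valN1 add0r.
Qed.

(** The strict case of the ultrametric inequality. *)
Lemma val_lt_add x y : x != 0 -> y != 0 -> v x < v y ->
  x + y != 0 /\ v (x + y) = v x.
Proof.
move=> x0 y0 lt_xy; have xy0 : x + y != 0.
  by apply: contraTneq lt_xy => /eqP; rewrite addr_eq0 => /eqP ->; rewrite valN ?ltxx.
split=> //; apply/eqP; rewrite eq_le.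
have := @valuationD _ _ v x y x0 y0 xy0; rewrite minEle (ltW lt_xy) => ->.
rewrite andbT; have := @valuationD _ _ v (x + y) (- y) xy0.
rewrite addrK oppr_eq0 valN // minElt => /(_ y0 x0).
by case: ifP => // _ le_yx; rewrite (lt_geF lt_xy) in le_yx.
Qed.

(** For x <> 0: the value of x is twice a value of v. *)
Definition even_val (x : E) : Prop := exists2 y, y != 0 & v x = v (y ^+ 2).

Lemma even_val_eq x z : v x = v z -> even_val x -> even_val z.
Proof. by move=> e [y y0 vx]; exists y; rewrite // -e. Qed.

Lemma even_val_sqr x : x != 0 -> even_val (x ^+ 2).
Proof. by exists x. Qed.

Lemma even_val_val0 x : v x = 0 -> even_val x.
Proof. by move=> vx; exists 1; rewrite ?oner_eq0 // expr1n val1. Qed.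

Lemma even_valN x : x != 0 -> even_val x -> even_val (- x).
Proof. by move=> x0; apply: even_val_eq; rewrite valN. Qed.

Lemma even_valM x y : x != 0 -> y != 0 ->
  even_val x -> even_val y -> even_val (x * y).
Proof.
move=> x0 y0 [a a0 va] [b b0 vb]; exists (a * b); first exact: mulf_neq0.
by rewrite valuationM // exprMn valuationM ?expf_neq0 // va vb.
Qed.

Lemma even_valMl x y : x != 0 -> y != 0 ->
  even_val x -> even_val (x * y) -> even_val y.
Proof.
move=> x0 y0 ex exy.
have x2 : x ^+ 2 != 0 by rewrite expf_neq0.
have -> : y = x * (x * y) / x ^+ 2 by rewrite mulrA -expr2 mulrAC mulfV ?mul1r.
rewrite -exprVn.
apply: even_valM; rewrite ?expf_neq0 ?invr_neq0 ?mulf_neq0 //.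
  by apply: even_valM; rewrite ?mulf_neq0.
by apply: even_val_sqr; rewrite invr_neq0.
Qed.

(** Unless v x = 0, the product (x + 1)(x + a) has the value of x^2 (when
    v x < 0) or of 1 (when v x > 0), so x and y^2 agree up to even value. *)
Lemma even_val_abscissa (a x y : E) : a != 0 -> v a = 0 -> x != 0 ->
  y ^+ 2 = x * ((x + 1) * (x + a)) -> even_val x.
Proof.
move=> a0 va x0 yE.
have [vx0|[z0 ez]] : v x = 0 \/
    (x + 1) * (x + a) != 0 /\ even_val ((x + 1) * (x + a)).
- have /orP := oag_le_total (v x) 0; rewrite !le_eqVlt.
  case=> /orP[/eqP|lt]; [by left| |by left|]; right.
    have [] := @val_lt_add x 1; rewrite ?oner_eq0 ?val1 // => u0 vu.
    have [] := @val_lt_add x a; rewrite ?va // => w0 vw.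
    split; first exact: mulf_neq0.
    by exists x; rewrite // !valuationM // vu vw.
  have [] := @val_lt_add 1 x; rewrite ?oner_eq0 ?val1 // addrC => u0 vu.
  have [] := @val_lt_add a x; rewrite ?va // addrC => w0 vw.
  split; first exact: mulf_neq0.
  by apply: even_val_val0; rewrite !valuationM // vu vw addr0.
- exact: even_val_val0.
apply: (even_valMl z0 x0 ez); rewrite mulrC -yE; apply: even_val_sqr.
by apply: (contraTneq _ (mulf_neq0 x0 z0)) => y0; rewrite -yE y0 expr0n eqxx.
Qed.

(** The degree of h^2 is even and that of f odd, so the leading terms cannot
    cancel: the leading coefficient is that of h^2, a square, or -1. *)
Lemma lead_size_sqr_sub_odd (f h : {poly E}) :
    f \is monic -> ~~ odd (size f) ->
  [/\ h ^+ 2 - f != 0, even_val (lead_coef (h ^+ 2 - f))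
    & size (h ^+ 2 - f) = maxn (size h).*2.-1 (size f)].
Proof.
move=> fm fodd; have f0 := monic_neq0 fm.
have [->|h0] := eqVneq h 0.
  rewrite expr0n sub0r oppr_eq0 lead_coefN (monicP fm) size_polyN size_poly0.
  by rewrite max0n; split=> //; apply: even_val_val0; rewrite valN1.
have sh : size (h ^+ 2) = (size h).*2.-1.
  by rewrite expr2 size_mul // addnn.
have h2odd : odd (size (h ^+ 2)).
  by rewrite sh -size_poly_gt0 in h0 *; case: (size h) h0 => //= n _; rewrite odd_double.
have lt_pos (p q : {poly E}) : (size p < size q)%N -> p != q.
  by apply: contraTneq => ->; rewrite ltnn.
have [lt|lt|eq] := ltngtP (size (h ^+ 2)) (size f).
- split; last by rewrite -sh addrC size_polyDl size_polyN // (maxn_idPr (ltnW lt)).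
    by rewrite subr_eq0 lt_pos.
  rewrite lead_coefDr ?size_polyN // lead_coefN (monicP fm).
  by apply: even_val_val0; rewrite valN1.
- split; last by rewrite -sh size_polyDl ?size_polyN // (maxn_idPl (ltnW lt)).
    by rewrite subr_eq0 eq_sym lt_pos.
  rewrite lead_coefDl ?size_polyN // lead_coef_exp.
  by apply: even_val_sqr; rewrite lead_coef_eq0.
- by rewrite -eq h2odd in fodd.
Qed.

(** The reduction step of the descent, by strong induction on the degree of g:
    at degree at most one, g is constant or its root is the abscissa of a point
    of y^2 = X f1; above, g is replaced by the cofactor k in h^2 - X f1 = k g.
    If h(0) = 0 then k(0) = 0 as well and the step uses k / X instead, which
    brings in f1(0). *)
Lemma even_val_descent (f1 : {poly E}) :
    f1 \is monic -> size f1 = 3%N -> f1.[0] != 0 -> even_val f1.[0] ->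
    (forall x y : E, x != 0 -> y ^+ 2 = ('X * f1).[x] -> even_val x) ->
  forall g h : {poly E}, g.[0] != 0 -> g %| h ^+ 2 - 'X * f1 ->
    even_val (g.[0] * lead_coef g).
Proof.
move=> f1m sf1 f10 ef1 points g.
have fm : 'X * f1 \is monic by rewrite monicMl // monicX.
have sf : size ('X * f1) = 4%N by rewrite mulrC size_mulX ?monic_neq0 // sf1.
have [n] := ubnP (size g); elim: n g => // n IHn g; rewrite ltnS => sgn h gz gdvd.
have g0 : g != 0 by apply: contraNneq gz => ->; rewrite horner0.
have lg0 : lead_coef g != 0 by rewrite lead_coef_eq0.
have [sg1|sg1] := leqP (size g) 1.
  rewrite (size1_polyC sg1) hornerC lead_coefC -expr2.
  by apply: even_val_sqr; rewrite (size1_polyC sg1) hornerC in gz.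
have [sg2|sg3] := leqP (size g) 2.
  have gE : g = lead_coef g *: 'X + g.[0]%:P.
    have /eqP sg : size g == 2%N by rewrite eqn_leq sg2.
    apply/polyP => i; rewrite lead_coefE sg horner_coef0 coefD coefZ coefX coefC.
    case: i => [|[|i]] /=; rewrite ?mulr0 ?mulr1 ?addr0 ?add0r //.
    by rewrite nth_default // sg.
  (* The root r of g gives the point (r, h(r)). *)
  pose r := - g.[0] / lead_coef g.
  have r0 : r != 0 by rewrite mulf_neq0 ?oppr_eq0 ?invr_neq0.
  have gr : root g r.
    by rewrite rootE gE hornerD hornerZ hornerX hornerC mulrC mulfVK // addNr.
  have /dvdpP[k /(congr1 (horner^~ r))] := gdvd.
  rewrite /= hornerM (rootP gr) mulr0 hornerD hornerN horner_exp.
  move=> /subr0_eq /(points _ _ r0) er.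
  have -> : g.[0] * lead_coef g = - r * lead_coef g ^+ 2.
    by rewrite /r; field.
  apply: even_valM; rewrite ?oppr_eq0 ?expf_neq0 //; first exact: even_valN.
  exact: even_val_sqr.
(* Only with deg h < deg g does the cofactor k have smaller degree than g. *)
have {h gdvd} [h sh gdvd] :
    exists2 h : {poly E}, (size h < size g)%N & g %| h ^+ 2 - 'X * f1.
  move: (ltn_modp h g) (divp_eq h g); rewrite g0.
  move: (h %/ g) (h %% g) => q r ltrg hE; exists r => //.
  have -> : r ^+ 2 - 'X * f1 = (h ^+ 2 - 'X * f1) - q * (h + r) * g.
    by rewrite hE; ring.
  by rewrite dvdp_sub // dvdp_mulIr.
have /dvdpP[k kE] := gdvd.
have [] := @lead_size_sqr_sub_odd _ h fm; rewrite ?sf // kE.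
rewrite mulf_eq0 lead_coefM => /norP[k0 _] el; rewrite size_mul // => sk.
have lk0 : lead_coef k != 0 by rewrite lead_coef_eq0.
(* deg (h^2 - f) <= max (2 deg g - 2) 3, hence deg k < deg g for deg g >= 2. *)
have skn : (size k < n)%N.
  by move: sk sgn sg3 sh; move: (size k) (size g) (size h) => i j l; lia.
have eqz := congr1 (fun p => p.[0]) kE.
rewrite /= hornerD hornerN horner_exp !hornerM hornerX mul0r subr0 in eqz.
have [hz|hz] := eqVneq h.[0] 0; last first.
  have kz : k.[0] != 0.
    by apply: contraNneq hz => kz; rewrite kz mul0r in eqz; rewrite -sqrf_eq0 eqz.
  have ek : even_val (k.[0] * lead_coef k).
    by apply: (IHn k skn h kz); rewrite kE dvdp_mulr.
  apply: (even_valMl _ _ ek); rewrite ?mulf_neq0 // mulrACA -eqz.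
  apply: even_valM el; rewrite ?expf_neq0 ?mulf_neq0 //.
  exact: even_val_sqr.
have /eqP kz : k.[0] == 0.
  by rewrite hz expr0n /= in eqz; have /esym/eqP := eqz; rewrite mulf_eq0 (negPf gz) orbF.
have /factor_theorem[h1 h1E] : root h 0 by rewrite rootE hz.
have /factor_theorem[k1 k1E] : root k 0 by rewrite rootE kz.
rewrite subr0 in h1E k1E.
have k1gE : 'X * h1 ^+ 2 - f1 = k1 * g.
  apply: (@mulfI _ 'X); first by rewrite polyX_eq0.
  have -> : 'X * (k1 * g) = k * g by rewrite k1E; ring.
  by rewrite -kE h1E; ring.
have lk1 : lead_coef k1 = lead_coef k by rewrite k1E lead_coefMX.
have eqz1 := congr1 (fun p => p.[0]) k1gE.
rewrite /= hornerD hornerN !hornerM hornerX mul0r sub0r in eqz1.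
have k1z : k1.[0] != 0.
  apply: contraNneq f10 => k1z; rewrite k1z mul0r in eqz1.
  by rewrite -oppr_eq0 eqz1.
have k10 : k1 != 0 by apply: contraNneq k0 => k10; rewrite k1E k10 mul0r.
have ek : even_val (k1.[0] * lead_coef k).
  rewrite -lk1; apply: (IHn k1 _ h k1z).
    by apply: leq_trans skn; rewrite k1E size_mulX.
  by rewrite kE k1E -mulrA dvdp_mulr.
apply: (even_valMl _ _ ek); rewrite ?mulf_neq0 // mulrACA -eqz1.
apply: even_valM el; rewrite ?mulf_neq0 ?oppr_eq0 //.
exact: even_valN.
Qed.
End Valuation.

Lemma units_field (E : fieldType) (x : E) : units E x <-> x != 0.
Proof.
split=> [[y xy1]|x0]; last by exists x^-1; rewrite mulfV.
by apply: contra_eq_neq xy1 => ->; rewrite mul0r eq_sym oner_eq0.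
Qed.

Lemma exists_odd_val (E : fieldType) (G : orderedAbelianGroup)
    (v : valuation E G) :
    [set v x | x in unit_squares E] <> [set v x | x in units E] ->
  exists2 t, t != 0 & ~ even_val v t.
Proof.
move=> hv; apply: contrapT => no_odd; apply: hv; apply/seteqP; split=> z /=.
  move=> [_ [y /units_field y0 <-] <-]; exists (y ^+ 2) => //.
  by apply/units_field; rewrite expf_neq0.
move=> [x /units_field x0 <-].
have [y y0 ->] : even_val v x by apply: contrapT => odd_x; apply: no_odd; exists x.
by exists (y ^+ 2) => //; exists y => //; apply/units_field.
Qed.

Lemma valuation_ring_unitsP (E : fieldType) (G : orderedAbelianGroup)
    (v : valuation E G) (a : E) :
  valuation_ring_units v a -> a != 0 /\ v a = 0.
Proof.
move=> [va [b vb ab1]].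
have a0 : a != 0 by apply/units_field; exists b.
have b0 : b != 0 by apply/units_field; exists a; rewrite mulrC.
have {}va : 0 <= v a by case: va a0 => // ->; rewrite eqxx.
have {}vb : 0 <= v b by case: vb b0 => // ->; rewrite eqxx.
split=> //; apply/eqP; rewrite eq_le va andbT.
have := oag_leD2l (v a) _ _ vb.
by rewrite -valuationM // ab1 val1 addr0.
Qed.

(** * The cubic X(X+1)(X+a) *)

Theorem proposition4p2 (E : fieldType) (hE : 2%N \notin [pchar E])
    (G : orderedAbelianGroup) (v : valuation E G)
    (hv : [set v x | x in unit_squares E] <> [set v x | x in units E])
    (a : E) (ha : valuation_ring_units v a) (ha1 : a <> 1) :
  ~ square_reflexive ('X * ('X + 1) * ('X + a%:P)).
Proof.
set f := (_ * _); move=> [f0 _ refl].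
have [a0 va] := valuation_ring_unitsP ha.
have a1 : a - 1 != 0 by rewrite subr_eq0; apply/eqP.
have [t t0 odd_t] := exists_odd_val hv.
pose rs : seq E := [:: 0; -1; -a].
have urs : uniq rs.
  rewrite /= !inE negb_or ![0 == _]eq_sym !oppr_eq0 oner_eq0 a0 eqr_opp.
  by apply/and3P; split=> //; apply/eqP => /esym.
have fE : f = \prod_(r <- rs) ('X - r%:P).
  by rewrite !big_cons big_nil /f; ring.
(* p s takes the values s, s, 1 at the roots 0, -1, -a, so p s^-1 will represent
   the inverse of p s. *)
pose p (s : E) : {poly E} :=
  s%:P + ((1 - s) / (a * (a - 1)))%:P * ('X * ('X + 1%:P)).
have pE s r : (p s).[r] = s + (1 - s) / (a * (a - 1)) * (r * (r + 1)).
  by rewrite /p hornerD hornerM hornerM hornerD !hornerC hornerX.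
have p0 s : (p s).[0] = s by rewrite pE mul0r mulr0 addr0.
have p1 s : (p s).[-1] = s by rewrite pE addNr !mulr0 addr0.
have pa s : (p s).[-a] = 1 by rewrite pE; field; rewrite a0 a1.
have fr r : r \in rs -> root f r by rewrite fE root_prod_XsubC.
have [||g [g0 cgf [_ [w _ <-] gE] [h _ hE2]]] := refl (in_quot f (p t)) _ _.
- exists (in_quot f (p t^-1)); rewrite -in_quotM -in_quot1.
  apply: (in_quot_eq_split urs fE) => r; rewrite !inE hornerM hornerC.
  by case/or3P=> /eqP->; rewrite ?p0 ?p1 ?pa ?mulr1 ?mulfV.
- left; exists t; first exact/units_field.
  by rewrite (quot_norm_split _ urs fE) !big_cons big_nil p0 p1 pa !mulr1.
have gr r : r \in rs -> g.[r] != 0.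
  by move=> rrs; apply: contraTneq (fr r rrs) => /eqP; apply: coprimep_root.
have gw r : r \in rs -> g.[r] = (p t).[r] * (w : {poly E}).[r] ^+ 2.
  move=> rrs; rewrite -(horner_in_quot g f0 (fr r rrs)) -gE expr2 !quot_mulE.
  by rewrite !(horner_in_quot, hornerM) ?fr.
have gdvd : g %| (h : {poly E}) ^+ 2 - f.
  by rewrite -in_quot_eq // expr2 in_quotM in_quotK -expr2 hE2.
have [k [d prodE]] : exists (k : nat) (d : E), \prod_(r <- rs) g.[r]
    = (-1) ^+ k * lead_coef g ^+ size rs * d ^+ 2.
  by apply: (prod_horner_square (h := h) g0); rewrite -fE.
have r0 : 0 \in rs by rewrite !inE eqxx.
have r1 : -1 \in rs by rewrite !inE eqxx orbT.
have r2 : -a \in rs by rewrite !inE eqxx !orbT.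
have l0 : lead_coef g != 0 by rewrite lead_coef_eq0.
have prod0 : \prod_(r <- rs) g.[r] != 0.
  by rewrite !big_cons big_nil !mulf_neq0 ?gr ?oner_eq0.
have d0 : d != 0.
  by apply: contraNneq prod0 => d0; rewrite prodE d0 expr0n mulr0.
have ev_lead : even_val v (lead_coef g).
  have ld0 : (lead_coef g * d) ^+ 2 != 0 by rewrite sqrf_eq0 mulf_neq0.
  have ev_s : even_val v ((-1) ^+ k * (lead_coef g * d) ^+ 2).
    apply: even_valM; rewrite ?signr_eq0 //; last exact/even_val_sqr/mulf_neq0.
    rewrite -signr_odd; apply: even_val_val0.
    by case: (odd k); rewrite ?valN1 ?val1.
  have s0 : (-1) ^+ k * (lead_coef g * d) ^+ 2 != 0.
    by rewrite mulf_neq0 ?signr_eq0.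
  apply: (even_valMl s0 l0 ev_s).
  have -> : (-1) ^+ k * (lead_coef g * d) ^+ 2 * lead_coef g = \prod_(r <- rs) g.[r].
    by rewrite prodE /=; ring.
  have prodW : \prod_(r <- rs) g.[r]
    = (t * (w : {poly E}).[0] * (w : {poly E}).[-1] * (w : {poly E}).[-a]) ^+ 2.
    by rewrite !big_cons big_nil !gw // p0 p1 pa; ring.
  rewrite prodW; apply: even_val_sqr; rewrite prodW in prod0.
  by rewrite sqrf_eq0 in prod0.
pose f1 : {poly E} := ('X + 1%:P) * ('X + a%:P).
have fE1 : f = 'X * f1 by rewrite /f mulrA.
have f1z : f1.[0] = a by rewrite /f1 !hornerE.
have ev_g0 : even_val v g.[0].
  apply: (even_valMl l0 (gr _ r0) ev_lead); rewrite mulrC.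
  apply: (even_val_descent (f1 := f1) _ _ _ _ _ (gr _ r0) (h := h)); rewrite -?fE1 ?f1z //.
  - by rewrite monicMl monicXaddC.
  - by rewrite size_mul -?size_poly_eq0 !size_XaddC.
  - exact: even_val_val0.
  - move=> x y x0 yE; apply: (even_val_abscissa (a := a) (y := y) a0 va x0).
    by rewrite yE fE1 /f1 !hornerE.
apply: odd_t.
have := gw _ r0; rewrite p0 => g0E.
have w0 : (w : {poly E}).[0] ^+ 2 != 0.
  by apply: contraNneq (gr _ r0) => z; rewrite g0E z mulr0.
apply: (even_valMl w0 t0); last by rewrite mulrC -g0E.
by apply: even_val_sqr; rewrite sqrf_eq0 in w0.
Qed.
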